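(* For any complex numbers $z_1,\dots,z_n$, the subalgebra $\mathcal{B}^S_n(z_1,\dots,z_n)$ of $\mathbb{C}[\mathfrak{S}_n]$ is commutative.
   Context: $\mathfrak{S}_n$ is the symmetric group. For distinct $r_1,\dots,r_m\in\{1,\dots,n\}$, $\pi^{[n]}_{r_1,\dots,r_m}:\mathbb{C}[\mathfrak{S}_m]\to\mathbb{C}[\mathfrak{S}_n]$ is the embedding induced by $i\mapsto r_i$. $A^{[m]}=\frac1{m!}\sum_{\sigma\in\mathfrak{S}_m}\mathrm{sign}(\sigma)\,\sigma$. For complex $z_1,\dots,z_n$ and $i=1,\dots,n$ put $$\Phi^{[n]}_i(u)=\sum_{1\le r_1<\dots<r_i\le n} i!\;\pi^{[n]}_{r_1,\dots,r_i}(A^{[i]})\prod_{1\le b\le n,\ b\notin\{r_1,\dots,r_i\}}(u-z_b)=\sum_{j=0}^{n-i}\Phi^{[n]}_{i,j}\,u^{n-i-j}.$$ $\mathcal{B}^S_n(z_1,\dots,z_n)$ is the subalgebra of $\mathbb{C}[\mathfrak{S}_n]$ generated by all $\Phi^{[n]}_{i,j}$, $i=1,\dots,n$, $j=0,\dots,n-i$. *)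

(* Defs.v *)
From HB Require Import structures.
From mathcomp Require Import all_boot all_order all_algebra all_fingroup all_field.

Set Implicit Arguments.
Unset Strict Implicit.
Unset Printing Implicit Defensive.

Import GRing.Theory.
Local Open Scope ring_scope.

(* The group algebra F[gT]: the function f stands for the formal sum of the
   (f x) x, and the product is convolution. The alias is needed because
   {ffun gT -> F} already carries the pointwise product. *)
Definition galg (F : fieldType) (gT : finGroupType) : Type := {ffun gT -> F}.

Section GroupAlgebra.
Variables (F : fieldType) (gT : finGroupType).
Local Notation A := (galg F gT).
Implicit Types (f g h : A) (x y : gT).

HB.instance Definition _ := Vector.copy (galg F gT) {ffun gT -> F^o}.

Definition gdelta x : A := [ffun y => (y == x)%:R].

Definition galg_mul f g : A := [ffun x => \sum_y f y * g (y^-1 * x)%g].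

Fact galg_mulA : associative galg_mul.
Proof.
move=> f g h; apply/ffunP=> x; rewrite !ffunE.
under eq_bigr => y _ do rewrite ffunE mulr_sumr.
under [RHS]eq_bigr => y _ do rewrite ffunE mulr_suml.
rewrite [RHS]exchange_big /=; apply: eq_bigr => y _.
rewrite (reindex_inj (mulgI y^-1)%g) /=; apply: eq_bigr => z _.
by rewrite mulrA invMg invgK -mulgA mulKVg.
Qed.

Fact galg_mul1l : left_id (gdelta 1%g) galg_mul.
Proof.
move=> f; apply/ffunP=> x; rewrite ffunE (bigD1 1%g) //= big1 => [|y /negPf y1].
  by rewrite ffunE eqxx mul1r invg1 mul1g addr0.
by rewrite ffunE y1 mul0r.
Qed.

Fact galg_mul1r : right_id (gdelta 1%g) galg_mul.
Proof.
move=> f; apply/ffunP=> x; rewrite ffunE (bigD1 x) //= big1 => [|y yx].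
  by rewrite ffunE mulVg eqxx mulr1 addr0.
by rewrite ffunE -eq_invg_mul invgK (negPf yx) mulr0.
Qed.

Fact galg_mulDl : left_distributive galg_mul +%R.
Proof.
move=> f g h; apply/ffunP=> x; rewrite !ffunE -big_split /=.
by apply: eq_bigr => y _; rewrite ffunE mulrDl.
Qed.

Fact galg_mulDr : right_distributive galg_mul +%R.
Proof.
move=> f g h; apply/ffunP=> x; rewrite !ffunE -big_split /=.
by apply: eq_bigr => y _; rewrite ffunE mulrDr.
Qed.

Fact galg_1_neq0 : gdelta 1%g != 0 :> A.
Proof.
by apply/eqP=> /ffunP/(_ 1%g); rewrite !ffunE eqxx; apply/eqP/oner_neq0.
Qed.

HB.instance Definition _ := GRing.Zmodule_isNzRing.Build (galg F gT)
  galg_mulA galg_mul1l galg_mul1r galg_mulDl galg_mulDr galg_1_neq0.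

Lemma galg_mulE f g x : (f * g) x = \sum_y f y * g (y^-1 * x)%g.
Proof. exact: ffunE. Qed.

Lemma galg_scaleE (a : F) f x : (a *: f) x = a * f x.
Proof. exact: (@ffunE _ (fun=> F)). Qed.

Fact galg_scaleAl (a : F) f g : a *: (f * g) = (a *: f) * g.
Proof.
apply/ffunP=> x; rewrite galg_scaleE !galg_mulE mulr_sumr.
by apply: eq_bigr => y _; rewrite galg_scaleE mulrA.
Qed.

Fact galg_scaleAr (a : F) f g : a *: (f * g) = f * (a *: g).
Proof.
apply/ffunP=> x; rewrite galg_scaleE !galg_mulE mulr_sumr.
by apply: eq_bigr => y _; rewrite galg_scaleE mulrCA.
Qed.

HB.instance Definition _ := GRing.Lmodule_isLalgebra.Build F (galg F gT) galg_scaleAl.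
HB.instance Definition _ := GRing.Lalgebra_isAlgebra.Build F (galg F gT) galg_scaleAr.
HB.instance Definition _ := Algebra_isFalgebra.Build F (galg F gT).

Lemma gdelta1 : gdelta 1%g = 1 :> A. Proof. by []. Qed.

Lemma gdeltaM x y : gdelta (x * y)%g = gdelta x * gdelta y :> A.
Proof.
apply/ffunP=> z; rewrite [RHS]ffunE (bigD1 x) //= big1 => [|t /negPf tx].
  by rewrite !ffunE eqxx mul1r addr0 (can2_eq (mulKVg x) (mulKg x)).
by rewrite ffunE tx mul0r.
Qed.

Lemma galg_sum_gdelta f : f = \sum_x f x *: gdelta x.
Proof.
apply/ffunP=> z; rewrite sum_ffunE (bigD1 z) //= big1 => [|x /negPf xz].
  by rewrite galg_scaleE ffunE eqxx mulr1 addr0.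
by rewrite galg_scaleE ffunE eq_sym xz mulr0.
Qed.

End GroupAlgebra.

(* 'S_n carries MathComp's group law, in which s * t is "s, then t". With the
   right-to-left law one gets the opposite group algebra, which has the same
   generated subalgebras and the same commuting pairs. *)

Section Phi.
Variable F : fieldType.

Definition embed_fun m n (r : {ffun 'I_m -> 'I_n}) (s : 'S_m) (x : 'I_n) : 'I_n :=
  if [pick k | r k == x] is Some k then r (s k) else x.

(* When r is injective this is the permutation r_k |-> r_(s k) that fixes all
   points outside r (perm_embedE); it is 1 by default otherwise. *)
Definition perm_embed m n (r : {ffun 'I_m -> 'I_n}) (s : 'S_m) : 'S_n :=
  insubd (1%g : 'S_n) (finfun (embed_fun r s)).

Lemma perm_embedE m n (r : {ffun 'I_m -> 'I_n}) (s : 'S_m) : injective r ->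
  (forall k, perm_embed r s (r k) = r (s k)) /\
  (forall x, x \notin codom r -> perm_embed r s x = x).
Proof.
move=> r_inj; set f := finfun (embed_fun r s).
have fr k : f (r k) = r (s k).
  rewrite ffunE /embed_fun; case: pickP => [l /eqP/r_inj-> //|/(_ k)].
  by rewrite eqxx.
have fx x : x \notin codom r -> f x = x.
  move=> xr; rewrite ffunE /embed_fun; case: pickP => // l /eqP lx.
  by rewrite -lx codom_f in xr.
have f_in x : (f x \in codom r) = (x \in codom r).
  case: (boolP (x \in codom r)) => [/codomP[k ->]|xr].
    by rewrite fr codom_f.
  by rewrite fx // (negPf xr).
have f_inj : injectiveb f.
  apply/injectiveP=> x y fxy.
  case: (boolP (x \in codom r)) (f_in y) => [/codomP[k xk]|xr].
    rewrite -fxy xk fr codom_f => /esym/codomP[l yl].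
    by move: fxy; rewrite xk yl !fr => /r_inj/perm_inj->.
  rewrite -fxy fx // (negPf xr) => /esym/negbT yr.
  by rewrite !fx in fxy.
have E x : perm_embed r s x = f x.
  by rewrite /perm_embed -/f -pvalE val_insubd f_inj.
by split=> [k|x xr]; rewrite E ?fr ?fx.
Qed.

Lemma perm_embedM m n (r : {ffun 'I_m -> 'I_n}) : injective r ->
  {morph perm_embed r : s t / (s * t)%g}.
Proof.
move=> r_inj s t; apply/permP=> x; rewrite permM.
have [Es Es'] := perm_embedE s r_inj; have [Et Et'] := perm_embedE t r_inj.
have [E E'] := perm_embedE (s * t)%g r_inj.
case: (boolP (x \in codom r)) => [/codomP[k ->]|xr].
  by rewrite E Es Et permM.
by rewrite E' // Es' // Et'.
Qed.

Definition galg_embed m n (r : {ffun 'I_m -> 'I_n}) (a : galg F 'S_m) :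
    galg F 'S_n :=
  \sum_(s : 'S_m) a s *: gdelta F (perm_embed r s).

Lemma galg_embedM m n (r : {ffun 'I_m -> 'I_n}) : injective r ->
  {morph galg_embed r : a b / a * b}.
Proof.
move=> r_inj a b; rewrite /galg_embed mulr_suml.
under [RHS]eq_bigr => s _ do rewrite mulr_sumr.
under [LHS]eq_bigr => s _ do rewrite galg_mulE scaler_suml.
rewrite exchange_big /=; apply: eq_bigr => s _.
rewrite (reindex_inj (mulgI s)) /=; apply: eq_bigr => t _.
by rewrite mulKg perm_embedM // gdeltaM -scalerAl -scalerAr scalerA.
Qed.

Definition antisymmetrizer m : galg F 'S_m :=
  (m`!%:R)^-1 *: \sum_(s : 'S_m) (-1) ^+ (odd_perm s) *: gdelta F s.

Definition increasing m n (r : {ffun 'I_m -> 'I_n}) : bool :=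
  [forall k : 'I_m, forall l : 'I_m, (k < l)%N ==> (r k < r l)%N].

Definition Phi n (z : 'I_n -> F) (i : nat) : {poly galg F 'S_n} :=
  \sum_(r : {ffun 'I_i -> 'I_n} | increasing r)
    (galg_embed r (antisymmetrizer i) *+ i`!)%:P *
    \prod_(b < n | b \notin codom r) ('X - ((z b)%:A)%:P).

Definition Phi_coef n (z : 'I_n -> F) (i j : nat) : galg F 'S_n :=
  (Phi z i)`_(n - i - j).

Lemma increasing_inj m n (r : {ffun 'I_m -> 'I_n}) :
  increasing r -> injective r.
Proof.
move=> /forallP rP k l rkl; apply/val_inj; case: (ltngtP k l) => // ltkl.
  by move/forallP: (rP k) => /(_ l); rewrite ltkl rkl ltnn.
by move/forallP: (rP l) => /(_ k); rewrite ltkl rkl ltnn.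
Qed.

Lemma Phi_expand n (z : 'I_n -> F) (i : nat) :
  Phi z i = \sum_(j < (n - i).+1) Phi_coef z i j *: 'X^(n - i - j).
Proof.
have szP : (size (Phi z i) <= (n - i).+1)%N.
  apply: (leq_trans (size_sum _ _ _)); apply/bigmax_leqP => r r_incr.
  rewrite mul_polyC; apply: (leq_trans (size_scale_leq _ _)).
  rewrite -big_filter size_prod_XsubC ltnS -sum1_size big_filter.
  rewrite (sum1_card [predC codom r]).
  have := cardC [in codom r]; rewrite (card_codom (increasing_inj r_incr)).
  by rewrite !card_ord => /(canRL (addKn i)) ->.
rewrite (reindex_inj rev_ord_inj) /=.
under eq_bigr => j _ do rewrite /Phi_coef subSS subKn -1?ltnS //.
rewrite -poly_def; apply/polyP=> k; rewrite coef_poly.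
by case: ltnP => // le_k; rewrite nth_default // (leq_trans szP).
Qed.

Definition BS n (z : 'I_n -> F) : {aspace galg F 'S_n} :=
  <<1 & [seq Phi_coef z i j | i <- iota 1 n, j <- iota 0 (n - i).+1]>>%AS.

End Phi.

(* Main.v *)
Require Import Defs.
From mathcomp Require Import all_boot all_order all_algebra all_fingroup all_field.
From mathcomp Require Import reals complex.
From mathcomp Require Import ring zify.

Set Implicit Arguments.
Unset Strict Implicit.
Unset Printing Implicit Defensive.

Import GRing.Theory.
Local Open Scope ring_scope.

(** Why the theorem holds.

    For a set S of points let a_S be the sum of sgn(s) s over the permutations
    s of S (signed_sum). After the factorials cancel, Phi_i(u) is the sum over
    |S| = i of a_S times the product of u - z_p over p outside S (Phi_coefE).
    In a_S a_T all factorisations of a given permutation w carry the same sign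
    sgn(w), so the coefficient of w is, up to this sign, the number of s in
    Sym(S) with s^-1 w in Sym(T) (signed_sumM). These s form a coset of
    Sym(S :&: T) or the empty set, and the first case occurs exactly when w
    moves only points of S :|: T and sends no point of T \ S into S \ T
    (young_countE). For a_T a_S the second condition is the same one for w^-1
    in place of w.

    Writing x_p = u - z_p and y_p = v - z_p, the commutation of Phi_i(u) and
    Phi_k(v) therefore says that the sum, over |S| = i and |T| = k with
    S :|: T = E, of the product of x over E \ S times the product of y over
    E \ T, subject to the condition on w, does not change when w is replaced
    by w^-1. Here E can be fixed, which makes |S :&: T| = i + k - |E| and the
    factorial constant.

    To prove this invariance, weight S and T by their sizes through two
    indeterminates and put X = beta x, Y = alpha y. For fixed T the sum over S
    factorises, and the whole sum becomes
      sum over T in E of the product over p in E of N_p([p in T], [w p in T])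
    with the 2 x 2 matrices N_p = [[Y_p, Y_p], [1, 1 + X_p]]
    (cover_sum_transfer). This is the trace of w composed with the tensor
    product of the N_p, and transposing all N_p amounts to inverting w. Since
    x_p - y_p = u - v is independent of p, the N_p lie on a line in the space of
    2 x 2 matrices, and two 2 x 2 matrices are simultaneously similar to their
    transposes when they are in general position. So one matrix Q conjugates
    every N_p to its transpose, its tensor power commutes with w, and the trace
    is unchanged (twisted_trace_transpose). General position is guaranteed by
    the indeterminates alpha, beta. *)

(** * Traces of tensor products twisted by a permutation *)

Lemma prod_sum_subset (K : comNzRingType) (I : finType) (E : {set I})
    (F : I -> bool -> K) :
  \prod_(p in E) \sum_(b : bool) F p b =
  \sum_(T : {set I} | T \subset E) \prod_(p in E) F p (p \in T).
Proof.
rewrite (big_distr_big false).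
rewrite (reindex_onto (fun T : {set I} => [ffun p => p \in T])
                      (fun f : {ffun I -> bool} => [set p | f p])) /=.
  apply: eq_big => [T|T _]; last by apply: eq_bigr => p _; rewrite ffunE.
  have ->: [set p | [ffun p => p \in T] p] = T.
    by apply/setP=> p; rewrite inE ffunE.
  rewrite eqxx andbT; apply/pfamilyP/subsetP => [[/subsetP sTE _] p pT|sTE].
    by apply: sTE; rewrite inE ffunE pT.
  by split=> [|//]; apply/subsetP=> p; rewrite inE ffunE eqbF_neg negbK; apply: sTE.
by move=> f _; apply/ffunP=> p; rewrite ffunE inE.
Qed.

(** The left-hand side is the trace, on the tensor product over p in E of copies
    of K^2, of the tensor product of the M_p followed by the permutation of the
    factors by w; on the right the M_p are transposed. The hypotheses say that Q
    conjugates M_p to its transpose, the inverse of Q being Q' / d. As the tensor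
    power of Q commutes with permutations of the factors, the two traces agree
    after multiplication by d ^ |E|. *)
Lemma twisted_trace_transpose (K : idomainType) (I : finType) (E : {set I})
    (w : {perm I}) (M : I -> bool -> bool -> K) (Q Q' : bool -> bool -> K)
    (d : K) :
  perm_on E w -> d != 0 ->
  (forall p a b, d * M p b a =
     \sum_(r : bool) \sum_(s : bool) Q a r * M p r s * Q' s b) ->
  (forall s t, \sum_(b : bool) Q' s b * Q b t = if s == t then d else 0) ->
  \sum_(T : {set I} | T \subset E) \prod_(p in E) M p (p \in T) (w p \in T) =
  \sum_(T : {set I} | T \subset E)
    \prod_(p in E) M p (p \in T) ((w^-1)%g p \in T).
Proof.
move=> wE d0 QM QQ; apply/esym/(mulfI (expf_neq0 #|E| d0)).
(* Expanding the d * M_p^T: the sets A and B choose the row and the column of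
   each M p, and T the row of Q and the column of Q'. *)
transitivity (\sum_(T : {set I} | T \subset E)
   \sum_(A : {set I} | A \subset E) \sum_(B : {set I} | B \subset E)
     (\prod_(p in E) M p (p \in A) (p \in B)) *
     \prod_(p in E) (Q' (p \in B) (p \in T) * Q (p \in T) (w p \in A))).
  rewrite mulr_sumr; apply: eq_bigr => T _.
  rewrite -prodr_const -big_split /=.
  under eq_bigr => p _ do rewrite QM.
  rewrite (prod_sum_subset _ (fun p r =>
    \sum_s Q ((w^-1)%g p \in T) r * M p r s * Q' s (p \in T))).
  apply: eq_bigr => A _.
  rewrite (prod_sum_subset _ (fun p s =>
    Q ((w^-1)%g p \in T) (p \in A) * M p (p \in A) s * Q' s (p \in T))).
  apply: eq_bigr => B _.
  rewrite !big_split /= (reindex_inj (@perm_inj _ w)) /=.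
  under eq_bigl => p do rewrite (perm_closed _ wE).
  under eq_bigr => p _ do rewrite permK.
  ring.
rewrite exchange_big /= mulr_sumr; apply: eq_bigr => A sAE.
rewrite exchange_big /=.
(* Summing over T leaves the product of the entries of Q' Q = d at (p in B) and
   (w p in A), so that only the preimage of A under w survives as B. *)
have sB : [set p | w p \in A] \subset E.
  by apply/subsetP=> p; rewrite inE => /(subsetP sAE); rewrite (perm_closed _ wE).
rewrite (bigD1 _ sB) /= [X in _ + X]big1 ?addr0 => [|B /andP[sBE neB]].
  rewrite -mulr_sumr mulrC; congr (_ * _); last first.
    by apply: eq_bigr => p _; rewrite inE.
  rewrite -(prod_sum_subset _ (fun p b =>
    Q' (p \in [set q | w q \in A]) b * Q b (w p \in A))).
  by rewrite -prodr_const; apply: eq_bigr => p _; rewrite QQ inE eqxx.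
rewrite -mulr_sumr.
rewrite -(prod_sum_subset _ (fun p b => Q' (p \in B) b * Q b (w p \in A))).
have [p pE npB]: exists2 p, p \in E & (p \in B) != (w p \in A).
  apply/exists_inP; apply: contraR neB; rewrite negb_exists_in => /forall_inP eB.
  apply/eqP/setP=> p; rewrite inE; have [/eB/negPn/eqP//|pE] := boolP (p \in E).
  rewrite (contraNF (subsetP sBE p) pE); apply/esym/negP=> /(subsetP sAE).
  by rewrite (perm_closed _ wE) (negPf pE).
by rewrite [X in _ * X](bigD1 p) //= QQ (negPf npB) mul0r mulr0.
Qed.

(** * Sums over pairs of sets with a given union *)

Definition avoids (I : finType) (w : {perm I}) (A B : {set I}) :=
  [forall p in A, w p \notin B].

Lemma avoidsV (I : finType) (w : {perm I}) (A B : {set I}) :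
  avoids (w^-1)%g A B = avoids w B A.
Proof.
apply/forall_inP/forall_inP => avo p pA; apply: contraL pA => /avo.
  by rewrite permK.
by rewrite permKV.
Qed.

(** The pairs (S, T) kept here are those with S :|: T = E for which w, if it
    moves only points of E, is a product of a permutation of S and one of T; see
    young_countE. *)
Definition cover_sum (K : nzRingType) (I : finType) (E : {set I}) (w : {perm I})
    (f : {set I} -> {set I} -> K) :=
  \sum_(S : {set I})
    \sum_(T : {set I} | (S :|: T == E) && avoids w (T :\: S) (S :\: T)) f S T.

Lemma prod_setD (K : comNzRingType) (I : finType) (E S : {set I}) (X : I -> K) :
  \prod_(p in E :\: S) X p = \prod_(p in E) if p \in S then 1 else X p.
Proof.
rewrite big_mkcond [RHS]big_mkcond; apply: eq_bigr => p _.
by rewrite inE; case: (p \in S) (p \in E) => [][].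
Qed.

(** For fixed T the set S must contain E \ T, so a point outside T contributes
    Y p. A point p of T may lie in S or not; it may be outside S, with
    weight X p, only if w p is not in S \ T, that is, only if w p lies in T. *)
Lemma cover_sum_transfer (K : comNzRingType) (I : finType) (E : {set I})
    (w : {perm I}) (X Y : I -> K) :
  perm_on E w ->
  cover_sum E w
    (fun S T => \prod_(p in E :\: S) X p * \prod_(p in E :\: T) Y p) =
  \sum_(T : {set I} | T \subset E) \prod_(p in E)
    if p \in T then (if w p \in T then 1 + X p else 1) else Y p.
Proof.
move=> wE; pose L (T : {set I}) p (s : bool) := if p \in T then
    if s then 1 else if w p \in T then X p else 0
  else if s then Y p else 0.
transitivity (\sum_(T : {set I} | T \subset E) \sum_(S : {set I} | S \subset E)
    \prod_(p in E) L T p (p \in S)); last first.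
  apply: eq_bigr => T _; rewrite -prod_sum_subset; apply: eq_bigr => p _.
  by rewrite big_bool /= /L; case: (p \in T) (w p \in T) => [][]; rewrite ?addr0.
rewrite /cover_sum.
under eq_bigr => S _ do rewrite big_mkcond.
rewrite exchange_big [RHS]big_mkcond /=; apply: eq_bigr => T _.
case: ifPn => [sTE|nTE]; last first.
  rewrite big1 // => S _; case: ifP => // /andP[/eqP defE _].
  by rewrite -defE subsetUr in nTE.
rewrite [RHS]big_mkcond; apply: eq_bigr => S _.
case: (boolP (S \subset E)) => [sSE|nSE]; last first.
  case: ifP => // /andP[/eqP defE _].
  by rewrite -defE subsetUl in nSE.
case: ifPn => [/andP[/eqP defE /forall_inP avo]|].
  rewrite !prod_setD -big_split /=; apply: eq_bigr => p pE; rewrite /L.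
  have wpE : w p \in E by rewrite (perm_closed _ wE).
  move: (avo p) pE wpE; rewrite -defE !inE.
  case: (p \in S); case: (p \in T) => //=; rewrite ?mul1r ?mulr1 //.
  by case: (w p \in T); rewrite ?orbT ?orbF //= => /(_ isT) /negPf->.
rewrite negb_and => /orP[neE|/forall_inPn[p]].
  have sSTE : S :|: T \subset E by rewrite subUset sSE.
  have [p pE]: exists2 p, p \in E & p \notin S :|: T.
    by apply/subsetPn; apply: contra neE => sE; rewrite eqEsubset sSTE.
  rewrite inE negb_or => /andP[/negPf pS /negPf pT].
  by rewrite (bigD1 p) //= /L pS pT mul0r.
rewrite !inE negbK => /andP[/negPf pS pT] /andP[/negPf wpT _].
by rewrite (bigD1 p) ?(subsetP sTE) //= /L pS pT wpT mul0r.
Qed.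

(** The matrices of cover_sum_transfer, N_p = [[Y p, Y p], [1, 1 + X p]] with
    rows and columns indexed by false, true, satisfy an affine relation between
    X p and Y p; this is what makes them simultaneously similar to their
    transposes. *)
Lemma cover_sumV_affine (K : idomainType) (I : finType) (E : {set I})
    (w : {perm I}) (X Y : I -> K) (l m v : K) :
  perm_on E w -> (forall p, v * Y p = l * X p + m) ->
  m * v - l * m - l * v != 0 ->
  let f (S T : {set I}) := \prod_(p in E :\: S) X p * \prod_(p in E :\: T) Y p in
  cover_sum E (w^-1)%g f = cover_sum E w f.
Proof.
move=> wE affYX d0 /=; rewrite !cover_sum_transfer ?perm_onV //; apply/esym.
(* Q = [[v - l, - l], [- l, m - l]]: the product Q N_p is symmetric precisely
   because v Y p = l X p + m. Q' is the adjugate of Q, and the determinant is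
   the scalar assumed to be nonzero. *)
pose Q (a b : bool) :=
  if a then if b then m - l else - l else if b then - l else v - l.
pose Q' (a b : bool) :=
  if a then if b then v - l else l else if b then l else m - l.
apply: (twisted_trace_transpose
  (M := fun p (a b : bool) => if a then (if b then 1 + X p else 1) else Y p)
  (Q := Q) (Q' := Q') wE d0) => [p|] [] []; rewrite !big_bool /Q /Q' /=.
1-4: ring: (affYX p).
all: ring.
Qed.

(** Two indeterminates al and be record the sizes of E \ T and E \ S. They serve
    twice: reading off coefficients isolates the pairs with prescribed sizes,
    and they keep the determinant of cover_sumV_affine from vanishing, whatever
    x, y and c are. *)
Lemma cover_sumV_graded (K : idomainType) (I : finType) (E : {set I})
    (w : {perm I}) (x y : I -> K) (c : K) (phi : nat -> nat -> K) :
  perm_on E w -> (forall p, x p = y p + c) ->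
  let f (S T : {set I}) := phi #|S| #|T| *
    (\prod_(p in E :\: S) x p * \prod_(p in E :\: T) y p) in
  cover_sum E (w^-1)%g f = cover_sum E w f.
Proof.
move=> wE xyc f.
pose al : {poly {poly K}} := 'X%:P; pose be : {poly {poly K}} := 'X.
pose X p := (x p)%:P%:P * be; pose Y p := (y p)%:P%:P * al.
(* From x p = y p + c: be * (al * y p) = al * (be * x p) - al * be * c. *)
have affYX p : be * Y p = al * X p + - (al * be * c%:P%:P).
  by rewrite /X /Y xyc !rmorphD /=; ring.
(* The cofactor of al * be has constant term -1. *)
have d0 : - (al * be * c%:P%:P) * be - al * - (al * be * c%:P%:P) - al * be != 0.
  have -> : - (al * be * c%:P%:P) * be - al * - (al * be * c%:P%:P) - al * be
    = al * be * ((al - be) * c%:P%:P - 1) by ring.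
  rewrite !mulf_neq0 ?polyC_eq0 ?polyX_eq0 //.
  apply/eqP=> /(congr1 (fun P => P.[0].[0])) /eqP.
  by rewrite /al /be !hornerE /= oppr0 mul0r sub0r oppr_eq0 oner_eq0.
(* The K-linear map that sends al ^ |E \ T| * be ^ |E \ S| to phi |S| |T|. *)
pose N := #|E|.+1.
pose ev (P : {poly {poly K}}) :=
  \sum_(s < N) \sum_(t < N) P`_s`_t * phi (#|E| - s)%N (#|E| - t)%N.
have ev0 : ev 0 = 0.
  by rewrite /ev big1 // => s _; rewrite big1 // => t _; rewrite !coef0 mul0r.
have evD : {morph ev : P P' / P + P'}.
  move=> P P'; rewrite /ev -big_split; apply: eq_bigr => s _ /=.
  by rewrite -big_split; apply: eq_bigr => t _; rewrite !coefD mulrDl.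
have evE w' : perm_on E w' -> cover_sum E w' f = ev (cover_sum E w' (fun S T =>
    \prod_(p in E :\: S) X p * \prod_(p in E :\: T) Y p)).
  move=> w'E; rewrite /cover_sum (big_morph ev evD ev0); apply: eq_bigr => S _.
  rewrite (big_morph ev evD ev0); apply: eq_bigr => T /andP[/eqP defE _].
  have sSE : S \subset E by rewrite -defE subsetUl.
  have sTE : T \subset E by rewrite -defE subsetUr.
  have ltS : (#|E :\: S| < N)%N by rewrite ltnS subset_leq_card ?subsetDl.
  have ltT : (#|E :\: T| < N)%N by rewrite ltnS subset_leq_card ?subsetDl.
  have -> : \prod_(p in E :\: S) X p * \prod_(p in E :\: T) Y p =
    ((\prod_(p in E :\: S) x p * \prod_(p in E :\: T) y p)%:P
       * 'X^(#|E :\: T|))%:P * 'X^(#|E :\: S|).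
    rewrite !big_split !prodr_const /= -!rmorph_prod /= !rmorphM /= rmorphXn /=.
    by rewrite /al /be; ring.
  rewrite /ev (bigD1 (Ordinal ltS)) //= [X in _ + X]big1 => [|s neS]; last first.
    rewrite big1 // => t _; rewrite coefCM coefXn.
    by rewrite [_ == _](negPf neS) mulr0 coef0 mul0r.
  rewrite addr0 (bigD1 (Ordinal ltT)) //= [X in _ + X]big1 => [|t neT].
    rewrite !coefCM !coefXn !eqxx !mulr1 coefCM coefXn eqxx mulr1 addr0 mulrC.
    by rewrite !cardsDS // !subKn ?subset_leq_card.
  rewrite coefCM coefXn eqxx mulr1 coefCM coefXn.
  by rewrite [_ == _](negPf neT) mulr0 mul0r.
rewrite (evE _ (perm_onV wE)) (evE _ wE); congr (ev _).
exact: (cover_sumV_affine wE affYX d0).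
Qed.

(** * Products of two Young subgroups *)

(** The points of B are put in place one at a time, each by a transposition of
    two points of S. *)
Lemma perm_on_extend (I : finType) (p : {perm I}) (S B : {set I}) :
  B \subset S -> {in B, forall b, p b \in S} ->
  exists2 s : {perm I}, perm_on S s & {in B, s =1 p}.
Proof.
have [n] := ubnP #|B|; elim: n B => // n IHn B /ltnSE leBn sBS pBS.
have [->|[b bB]] := set_0Vmem B.
  by exists 1%g => [|b]; rewrite ?perm_on1 ?inE.
have sB'B : B :\ b \subset B by apply: subsetDl.
have [||a /(subsetP sB'B)/pBS //|s sS sp] := IHn (B :\ b).
- by rewrite (cardsD1 b) bB in leBn.
- exact: subset_trans sB'B sBS.
exists (s * tperm (s b) (p b))%g => [|a aB].
  rewrite perm_onM //; apply: subset_trans (tperm_on _ _) _.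
  by rewrite subUset !sub1set perm_closed // (subsetP sBS) // pBS.
rewrite permM; have [->|neab] := eqVneq a b; first by rewrite tpermL.
have sa : s a = p a by apply: sp; rewrite !inE neab.
rewrite tpermD //; first by rewrite (inj_eq perm_inj) eq_sym.
by rewrite sa (inj_eq perm_inj) eq_sym.
Qed.

Lemma perm_onI (I : finType) (S T : {set I}) (s : {perm I}) :
  perm_on (S :&: T) s = perm_on S s && perm_on T s.
Proof.
apply/subsetP/andP=> [sST|[/subsetP sS /subsetP sT] x sx].
  by split; apply/subsetP=> x /sST; rewrite inE => /andP[].
by rewrite inE sS ?sT.
Qed.

(** The number of factorisations w = s * t with s in Sym(S) and t in Sym(T). *)
Definition young_count (I : finType) (S T : {set I}) (w : {perm I}) : nat :=
  #|[set s : {perm I} | perm_on S s && perm_on T (s^-1 * w)%g]|.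

(** If w = s * t, a point p of T \ S is fixed by s and sent by t into T; hence
    the condition. Conversely s has to satisfy s^-1 = w^-1 on S \ T, as t fixes
    these points, and w^-1 maps S \ T into S by the condition; any permutation
    of S with this property gives a factorisation. Two factorisations differ by
    an element of Sym(S) :&: Sym(T) = Sym(S :&: T). *)
Lemma young_countE (I : finType) (S T : {set I}) (w : {perm I}) :
  young_count S T w =
  if perm_on (S :|: T) w && avoids w (T :\: S) (S :\: T)
  then #|S :&: T|`! else 0%N.
Proof.
rewrite /young_count; set C := [set s | _].
case: ifPn => [/andP[wE /forall_inP avo] | ].
  (* s0 is the inverse of the first factor of one factorisation of w. *)
  have [||s0 s0S s0w] := @perm_on_extend I (w^-1)%g S (S :\: T).
  - exact: subsetDl.
  - move=> b bB; have: (w^-1)%g b \in S :|: T.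
      by rewrite perm_closed ?perm_onV // inE; case/setDP: bB => ->.
    rewrite inE => /orP[] // wbT; apply/negPn/negP=> wbS.
    have /avo : (w^-1)%g b \in T :\: S by rewrite inE wbS.
    by rewrite permKV bB.
  have s0T : perm_on T (s0 * w)%g.
    apply/subsetP=> y; rewrite inE; apply: contraR => yT; rewrite permM.
    have [yS|yS] := boolP (y \in S); first by rewrite s0w ?permKV // inE yT.
    by rewrite (out_perm s0S yS) (out_perm wE) // inE negb_or yS.
  rewrite -card_Sym -(card_lcoset (Sym (S :&: T)) (s0^-1)%g); apply: eq_card => s.
  rewrite mem_lcoset invgK /C !inE perm_onI.
  have ->: (s^-1 * w = (s0 * s)^-1 * (s0 * w))%g by rewrite invMg !mulgA mulgKV.
  apply/andP/andP=> [][sS sT]; split.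
  - exact: perm_onM.
  - have := perm_onM sT (perm_onV s0T).
    by rewrite mulgK => /perm_onV; rewrite invgK.
  - by rewrite -(mulKg s0 s) perm_onM ?perm_onV.
  - by rewrite perm_onM ?perm_onV.
apply: contraNeq; rewrite cards_eq0 => /set0Pn[s]; rewrite inE => /andP[sS tT].
have ew : w = (s * (s^-1 * w))%g by rewrite mulKVg.
set t := (s^-1 * w)%g in tT ew.
apply/andP; split.
  by rewrite ew perm_onM //; [apply: subset_trans sS _|apply: subset_trans tT _];
    rewrite ?subsetUl ?subsetUr.
apply/forall_inP=> p /setDP[pT pS].
by rewrite ew permM (out_perm sS pS) inE (perm_closed _ tT) pT.
Qed.

(** Grouping the pairs (S, T) by E = S :|: T: the points outside E contribute a
    common factor, and |S :&: T| = i + j - |E|. The permutation v, which will be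
    w or its inverse, is kept separate from w because perm_on does not
    distinguish these two but avoids does. *)
Lemma sum_young_cover (K : comNzRingType) (I : finType) (w v : {perm I})
    (x y : I -> K) (i j : nat) :
  \sum_(S : {set I} | #|S| == i) \sum_(T : {set I} | #|T| == j)
    (\prod_(p | p \notin S) x p * \prod_(p | p \notin T) y p) *
      (if perm_on (S :|: T) w && avoids v (T :\: S) (S :\: T)
       then #|S :&: T|`! else 0%N)%:R =
  \sum_(E : {set I} | perm_on E w) \prod_(p | p \notin E) (x p * y p) *
    cover_sum E v (fun S T =>
      (if (#|S| == i) && (#|T| == j) then (i + j - #|E|)`!%:R else 0) *
      (\prod_(p in E :\: S) x p * \prod_(p in E :\: T) y p)).
Proof.
pose G (E S T : {set I}) := \prod_(p | p \notin E) (x p * y p) *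
  ((if (#|S| == i) && (#|T| == j) then (i + j - #|E|)`!%:R else 0) *
    (\prod_(p in E :\: S) x p * \prod_(p in E :\: T) y p)).
transitivity (\sum_(S : {set I}) \sum_(T : {set I}) \sum_(E : {set I} | perm_on E w)
  if (S :|: T == E) && avoids v (T :\: S) (S :\: T) then G E S T else 0).
  rewrite big_mkcond; apply: eq_bigr => S _.
  case: (eqVneq #|S| i) => [cS|neS]; last first.
    rewrite big1 // => T _; rewrite big1 // => E _.
    by rewrite /G (negPf neS) mul0r mulr0 if_same.
  rewrite big_mkcond; apply: eq_bigr => T _.
  case: (eqVneq #|T| j) => [cT|neT]; last first.
    by rewrite big1 // => E _; rewrite /G (negPf neT) andbF mul0r mulr0 if_same.
  rewrite [RHS]big_mkcond [RHS](bigD1 (S :|: T)) //=.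
  rewrite [X in _ + X]big1 ?addr0 => [|E]; last first.
    by rewrite eq_sym => /negPf->; rewrite if_same.
  rewrite eqxx /=; case: (perm_on _ _); last by rewrite mulr0.
  case: (avoids _ _ _); last by rewrite mulr0.
  rewrite /G cS cT !eqxx /=.
  have -> : (i + j - #|S :|: T|)%N = #|S :&: T| by rewrite -cS -cT -cardsUI addKn.
  have splitP (A : {set I}) (z : I -> K) : A \subset S :|: T ->
      \prod_(p | p \notin A) z p =
      \prod_(p in (S :|: T) :\: A) z p * \prod_(p | p \notin S :|: T) z p.
    move=> sA; rewrite (bigID (mem (S :|: T))) /=.
    congr (_ * _); apply: eq_bigl => p.
      by rewrite !inE.
    by apply: andb_idl; apply: contra => /(subsetP sA).
  rewrite (splitP S x (subsetUl _ _)) (splitP T y (subsetUr _ _)) big_split /=.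
  by rewrite [RHS]mulrCA [RHS]mulrC; congr (_ * _); rewrite mulrACA mulrC.
rewrite [RHS](eq_bigr (fun E => \sum_(S : {set I}) \sum_(T : {set I})
    if (S :|: T == E) && avoids v (T :\: S) (S :\: T) then G E S T else 0)).
  by rewrite [RHS]exchange_big /=; apply: eq_bigr => S _; rewrite exchange_big.
move=> E _; rewrite /cover_sum mulr_sumr; apply: eq_bigr => S _.
by rewrite mulr_sumr big_mkcond.
Qed.

(** The commutation of Phi_i(u) and Phi_j(v), read off at the permutation w:
    interchanging S and T in young_count replaces w by its inverse in the
    condition of young_countE. *)
Lemma young_count_sym (K : idomainType) (I : finType) (w : {perm I})
    (x y : I -> K) (c : K) (i j : nat) :
  (forall p, x p = y p + c) ->
  \sum_(S : {set I} | #|S| == i) \sum_(T : {set I} | #|T| == j)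
    (\prod_(p | p \notin S) x p * \prod_(p | p \notin T) y p) *
      (young_count S T w)%:R =
  \sum_(S : {set I} | #|S| == i) \sum_(T : {set I} | #|T| == j)
    (\prod_(p | p \notin S) x p * \prod_(p | p \notin T) y p) *
      (young_count T S w)%:R.
Proof.
move=> xyc.
pose phi (E : {set I}) (s t : nat) : K :=
  if (s == i) && (t == j) then (i + j - #|E|)`!%:R else 0.
transitivity (\sum_(E : {set I} | perm_on E w)
    \prod_(p | p \notin E) (x p * y p) * cover_sum E w (fun S T =>
      phi E #|S| #|T| * (\prod_(p in E :\: S) x p * \prod_(p in E :\: T) y p))).
  rewrite -sum_young_cover; apply: eq_bigr => S _; apply: eq_bigr => T _.
  by rewrite young_countE.
under eq_bigr => E wE do rewrite -(cover_sumV_graded (phi E) wE xyc).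
rewrite -sum_young_cover; apply: eq_bigr => S _; apply: eq_bigr => T _.
by rewrite young_countE (setUC T) (setIC T) avoidsV.
Qed.

(** * The elements Phi as sums over subsets *)

Lemma sorted_enum_ord n (S : {pred 'I_n}) :
  sorted (fun k l : 'I_n => (k < l)%N) (enum S).
Proof.
rewrite /enum_mem -enumT sorted_filter //; first by move=> k l m; apply: ltn_trans.
by rewrite -(@sorted_map _ _ val ltn) val_enum_ord iota_ltn_sorted.
Qed.

(** Increasing maps correspond to their images: an increasing map lists its
    image in the order of enum, the only strictly increasing listing. *)
Lemma sum_increasing (V : nmodType) m n (G : {set 'I_n} -> V) :
  \sum_(r : {ffun 'I_m -> 'I_n} | increasing r) G [set x in codom r] =
  \sum_(S : {set 'I_n} | #|S| == m) G S.
Proof.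
pose D := [set r : {ffun 'I_m -> 'I_n} | increasing r].
have incrP (r : {ffun 'I_m -> 'I_n}) : increasing r ->
    {homo r : k l / (k < l)%N >-> (k < l)%N}.
  by move=> /forallP r_incr k l; apply/implyP/(forallP (r_incr k)).
pose im (r : {ffun 'I_m -> 'I_n}) := [set x in codom r].
have im_inj : {in D &, injective im}.
  move=> r1 r2; rewrite !inE => r1_incr r2_incr /setP eq12.
  have srt (r : {ffun 'I_m -> 'I_n}) : increasing r ->
      sorted (fun k l : 'I_n => (k < l)%N) (codom r).
    move=> /incrP r_homo; rewrite codomE; apply: homo_sorted r_homo _ _.
    exact: sorted_enum_ord.
  have /eq_in_map e12 : [seq r1 x | x <- enum 'I_m] = [seq r2 x | x <- enum 'I_m].
    rewrite -!codomE; apply: irr_sorted_eq (srt _ r1_incr) (srt _ r2_incr) _.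
    - by move=> k l p; apply: ltn_trans.
    - by move=> k; apply: ltnn.
    by move=> x; have := eq12 x; rewrite !inE.
  by apply/ffunP=> k; apply: e12; rewrite mem_enum.
have imD : im @: D = [set S : {set 'I_n} | #|S| == m].
  apply/setP=> S; rewrite inE; apply/imsetP/eqP => [[r]|cS].
    rewrite inE => r_incr ->; rewrite cardsE (card_codom (increasing_inj r_incr)).
    exact: card_ord.
  pose r := [ffun k : 'I_m => enum_val (cast_ord (esym cS) k)].
  exists r; last first.
    apply/setP=> x; rewrite inE; apply/idP/codomP => [xS|[k ->]].
      exists (cast_ord cS (enum_rank_in xS x)).
      by rewrite ffunE cast_ordK enum_rankK_in.
    by rewrite ffunE enum_valP.
  rewrite inE; apply/forallP=> k; apply/forallP=> l; apply/implyP=> ltkl.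
  rewrite !ffunE !(enum_val_nth (r k)).
  apply: sorted_ltn_nth (sorted_enum_ord S) _ _ _ _ _ => //.
  - by move=> a b c; apply: ltn_trans.
  - by rewrite inE -cardE ltn_ord.
  - by rewrite inE -cardE ltn_ord.
transitivity (\sum_(S in im @: D) G S); last by apply: eq_bigl => S; rewrite imD inE.
by rewrite big_imset //; apply: eq_bigl => r; rewrite inE.
Qed.

Section PermEmbed.
Variables (m n : nat) (r : {ffun 'I_m -> 'I_n}).
Hypothesis r_inj : injective r.

Lemma perm_embed1 : perm_embed r 1 = 1%g.
Proof.
by apply: (mulgI (perm_embed r 1)); rewrite -perm_embedM // !mulg1.
Qed.

Lemma perm_embed_tperm a b : perm_embed r (tperm a b) = tperm (r a) (r b).
Proof.
have [Er Efix] := perm_embedE (tperm a b) r_inj.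
apply/permP=> x; have [/codomP[k ->]|xr] := boolP (x \in codom r).
  by rewrite Er -inj_tperm.
by rewrite Efix // tpermD //; apply: contraNneq xr => <-; apply: codom_f.
Qed.

(** The embedding is a morphism that maps transpositions to transpositions. *)
Lemma odd_perm_embed s : odd_perm (perm_embed r s) = odd_perm s.
Proof.
case: (prod_tpermP s) => ts -> _; elim: ts => [|[a b] ts IHts].
  by rewrite !big_nil perm_embed1 !odd_perm1.
rewrite !big_cons perm_embedM // !odd_permM IHts perm_embed_tperm !odd_tperm.
by rewrite (inj_eq r_inj).
Qed.

Lemma perm_embed_inj : injective (perm_embed r).
Proof.
move=> s t est; apply/permP=> k; apply: r_inj.
by rewrite -(perm_embedE s r_inj).1 est (perm_embedE t r_inj).1.
Qed.

(** An injective map between sets with the same cardinal m! is onto. *)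
Lemma perm_embed_im :
  [set perm_embed r s | s in [set: 'S_m]] = Sym [set x in codom r].
Proof.
apply/eqP; rewrite eqEcard; apply/andP; split.
  apply/subsetP=> _ /imsetP[s _ ->]; rewrite inE; apply/subsetP=> x.
  by rewrite !inE; apply: contraR => /(perm_embedE s r_inj).2->.
by rewrite card_Sym card_imset ?cardsT ?card_Sn ?cardsE ?card_codom ?card_ord //;
  apply: perm_embed_inj.
Qed.

End PermEmbed.

Section SignedSum.
Variable F : fieldType.

Definition signed_sum n (S : {set 'I_n}) : galg F 'S_n :=
  [ffun w : 'S_n => if perm_on S w then (-1) ^+ w else 0].

(** sgn(s) sgn(s^-1 w) = sgn(w) does not depend on s. *)
Lemma signed_sumM n (S T : {set 'I_n}) (w : 'S_n) :
  (signed_sum S * signed_sum T) w = (-1) ^+ w * (young_count S T w)%:R.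
Proof.
rewrite galg_mulE /young_count -sum1_card natr_sum mulr_sumr.
rewrite [RHS]big_mkcond; apply: eq_bigr => s _; rewrite !ffunE inE.
case: (perm_on S s); case: (perm_on T _); rewrite /= ?mul0r ?mulr0 //.
by rewrite mulr1 odd_permM odd_permV signr_addb mulrA -expr2 sqrr_sign mul1r.
Qed.

Lemma galg_embed_antisymmetrizer m n (r : {ffun 'I_m -> 'I_n}) :
  m`!%:R != 0 :> F -> injective r ->
  galg_embed r (antisymmetrizer F m) *+ m`! = signed_sum [set x in codom r].
Proof.
move=> fact0 r_inj; apply/ffunP=> w.
rewrite -scaler_nat galg_scaleE /galg_embed sum_ffunE mulr_sumr [RHS]ffunE.
have term s : m`!%:R * (antisymmetrizer F m s *: gdelta F (perm_embed r s)) w =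
    (-1) ^+ s * (w == perm_embed r s)%:R.
  rewrite galg_scaleE [gdelta _ _ _]ffunE /antisymmetrizer galg_scaleE sum_ffunE.
  rewrite mulrA mulVKf //; congr (_ * _).
  rewrite (bigD1 s) //= big1 => [|t nets].
    by rewrite galg_scaleE ffunE eqxx mulr1 addr0.
  by rewrite galg_scaleE ffunE eq_sym (negPf nets) mulr0.
under eq_bigr => s _ do rewrite term.
case: ifPn => [wS|nwS].
  have: w \in Sym [set x in codom r] by rewrite inE.
  rewrite -(perm_embed_im r_inj) => /imsetP[s _ ->].
  rewrite odd_perm_embed // (bigD1 s) //= big1 => [|t nets].
    by rewrite eqxx mulr1 addr0.
  by rewrite (inj_eq (perm_embed_inj r_inj)) eq_sym (negPf nets) mulr0.
rewrite big1 // => s _; case: eqP => [ew|_]; last by rewrite mulr0.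
have: perm_embed r s \in Sym [set x in codom r].
  by rewrite -(perm_embed_im r_inj) imset_f ?inE.
by rewrite inE -ew (negPf nwS).
Qed.

Lemma Phi_coefE n (z : 'I_n -> F) (i j : nat) :
  i`!%:R != 0 :> F ->
  Phi_coef z i j = \sum_(S : {set 'I_n} | #|S| == i)
    (\prod_(b | b \notin S) ('X - (z b)%:P))`_(n - i - j) *: signed_sum S.
Proof.
move=> fact0; rewrite -sum_increasing /Phi_coef /Phi coef_sum.
apply: eq_bigr => r r_incr.
rewrite galg_embed_antisymmetrizer //; last exact: increasing_inj.
have -> : \prod_(b < n | b \notin codom r) ('X - ((z b)%:A)%:P) =
   map_poly (in_alg (galg F 'S_n))
     (\prod_(b < n | b \notin [set x in codom r]) ('X - (z b)%:P)).
  rewrite rmorph_prod; apply: eq_big => [b|b _]; first by rewrite inE.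
  by rewrite rmorphB /= map_polyX map_polyC.
by rewrite coefCM coef_map /= -scalerAr mulr1.
Qed.

End SignedSum.

(** * Commutativity *)

Lemma signed_sum_combM (F : fieldType) n (P Q : pred {set 'I_n})
    (f g : {set 'I_n} -> F) (w : 'S_n) :
  ((\sum_(S | P S) f S *: signed_sum F S) *
   (\sum_(T | Q T) g T *: signed_sum F T)) w =
  (-1) ^+ w * \sum_(S | P S) \sum_(T | Q T) f S * g T * (young_count S T w)%:R.
Proof.
rewrite mulr_suml sum_ffunE mulr_sumr; apply: eq_bigr => S _.
rewrite mulr_sumr sum_ffunE mulr_sumr; apply: eq_bigr => T _.
by rewrite -scalerAl -scalerAr !galg_scaleE signed_sumM mulrA mulrCA.
Qed.

(** The two spectral parameters u and v are the indeterminates of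
    {poly {poly F}}, u being the outer one; a pair of coefficients of Phi_i(u)
    and Phi_k(v) is a double coefficient of young_count_sym. *)
Lemma Phi_coef_comm (F : fieldType) n (z : 'I_n -> F) (i j k l : nat) :
  i`!%:R != 0 :> F -> k`!%:R != 0 :> F ->
  Phi_coef z i j * Phi_coef z k l = Phi_coef z k l * Phi_coef z i j.
Proof.
move=> facti factk; rewrite !Phi_coefE //.
set a := (n - i - j)%N; set b := (n - k - l)%N.
pose P (S : {set 'I_n}) : {poly F} := \prod_(c | c \notin S) ('X - (z c)%:P).
apply/ffunP=> w.
pose x c : {poly {poly F}} := 'X - (z c)%:P%:P.
pose y c : {poly {poly F}} := ('X - (z c)%:P)%:P.
have coef_xy (S T : {set 'I_n}) (N : nat) :
    (((\prod_(c | c \notin S) x c * \prod_(c | c \notin T) y c) * N%:R)`_a)`_b =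
    (P S)`_a * (P T)`_b * N%:R.
  have -> : \prod_(c | c \notin S) x c = map_poly polyC (P S).
    rewrite rmorph_prod; apply: eq_bigr => c _.
    by rewrite rmorphB /= map_polyX map_polyC.
  rewrite -rmorph_prod /= mulr_natr !coefMn coefMC coef_map /= coefCM.
  by rewrite mulr_natr.
have xyc c : x c = y c + ('X - 'X%:P).
  by rewrite /x /y rmorphB /=; ring.
rewrite !signed_sum_combM [in RHS]exchange_big; congr (_ * _).
have /(congr1 (fun Q : {poly {poly F}} => Q`_a`_b)) := young_count_sym w i k xyc.
rewrite !coef_sum => eq_ab.
transitivity (\sum_(S : {set 'I_n} | #|S| == i) \sum_(T : {set 'I_n} | #|T| == k)
  (((\prod_(c | c \notin S) x c * \prod_(c | c \notin T) y c) *
     (young_count S T w)%:R)`_a)`_b).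
  by apply: eq_bigr => S _; apply: eq_bigr => T _; rewrite coef_xy.
transitivity (\sum_(S : {set 'I_n} | #|S| == i) \sum_(T : {set 'I_n} | #|T| == k)
  (((\prod_(c | c \notin S) x c * \prod_(c | c \notin T) y c) *
     (young_count T S w)%:R)`_a)`_b); last first.
  apply: eq_bigr => S _; apply: eq_bigr => T _; rewrite coef_xy.
  by congr (_ * _); rewrite mulrC.
have split_coef (G : {set 'I_n} -> {set 'I_n} -> {poly {poly F}}) :
    \sum_(S : {set 'I_n} | #|S| == i)
      \sum_(T : {set 'I_n} | #|T| == k) ((G S T)`_a)`_b =
    \sum_(S : {set 'I_n} | #|S| == i) ((\sum_(T : {set 'I_n} | #|T| == k) G S T)`_a)`_b.
  by apply: eq_bigr => S _; rewrite !coef_sum.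
by rewrite !split_coef.
Qed.

(** Centralisers are subalgebras: V lies in the centraliser of V, hence agenv V
    does; so V lies in the centraliser of agenv V, hence agenv V does. *)
Lemma agenv_comm (F : fieldType) (aT : falgType F) (V : {vspace aT}) :
  {in V &, commutative *%R} -> {in agenv V &, commutative *%R}.
Proof.
have sub_cent (W : {vspace aT}) : (V <= 'C(W) -> agenv V <= 'C(W))%VS.
  move=> sVC; apply: agenv_sub_modl; first by rewrite -memvE centv1.
  by apply: subv_trans (prodvSl _ sVC) _; rewrite prodv_id.
by move=> /centvsP/sub_cent; rewrite centvC => /sub_cent/centvsP.
Qed.

Lemma adjoin_seq_comm (F : fieldType) (aT : falgType F) (vs : seq aT) :
  {in vs &, commutative *%R} -> {in <<1 & vs>>%VS &, commutative *%R}.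
Proof.
move=> vs_comm; apply/agenv_comm/centvsP; rewrite subv_add.
rewrite -memvE centv1 /= centvC subv_add -memvE centv1 /=.
apply/span_subvP => v vs_v; rewrite -subv_cent1.
by apply/span_subvP => u vs_u; apply/cent1vP/vs_comm.
Qed.

(** The factorials must be invertible because the antisymmetrizers are defined
    by dividing by them. *)
Lemma BS_comm (F : fieldType) n (z : 'I_n -> F) :
  n`!%:R != 0 :> F -> {in BS z &, commutative *%R}.
Proof.
move=> factn; apply: adjoin_seq_comm.
have fact0 i : (i <= n)%N -> i`!%:R != 0 :> F.
  move=> le_in; apply: contraNneq factn => i0.
  by rewrite -(bin_fact le_in) mulnCA natrM i0 mul0r.
move=> a b /allpairsPdep[i [j [iI _ ->]]] /allpairsPdep[k [l [kI _ ->]]].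
by apply: Phi_coef_comm; apply: fact0; move: iI kI; rewrite !mem_iota; lia.
Qed.

Local Open Scope complex_scope.

Theorem proposition2p4 (R : realType) (n : nat) (z : 'I_n -> R[i]) :
  {in BS z &, forall a b : galg R[i] 'S_n, a * b = b * a}.
Proof. by apply: BS_comm; rewrite Num.Theory.pnatr_eq0 -lt0n fact_gt0. Qed.
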